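(* Let $M\ge0$ and $n\ge1$. Let $A_n(\lambda)$ be the polynomials defined by $A_0(\lambda)=1$, $A_1(\lambda)=\lambda-\frac{1+2M}{1+M}$ and $A_n(\lambda)=(\lambda-2)A_{n-1}(\lambda)-A_{n-2}(\lambda)$ for $n\ge2$, let $\mu_{1,n}$ be the smallest zero of $A_n$, and let $M_n=1/\sqrt{\mu_{1,n}}$ be the Markov-Bernstein constant. Then $$\frac{1}{\sqrt{q_n^{(2)}}}\le M_n\le\sqrt{\frac{n(n+1)(3+(n+2)M)}{1+(n+1)M}},$$ where $$q_n^{(2)}=\frac{30\,(1+(n+1)M)}{(n+1)(2n+1)}\,\frac{p_{n-1}^{(1)}}{p_{n-1}^{(2)}},$$ $$p_j^{(1)}=1+M(2+j)+\frac{M^2}{6}(2+j)(3+2j),$$ $$p_j^{(2)}=5+5M(3+j)+M^2(3+j)(5+2j)+\frac{M^3}{6}(2+j)(3+j)(5+2j).$$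
   Context: The zeros of $A_n$ are real and positive. $M_n$ is the constant in the Markov-Bernstein inequality $c_1((p')^2)\le M_n^2\,c_0(p^2)$ for real polynomials $p$ of degree at most $n$, where $c_0(p)=\int_0^\infty p(x)e^{-x}dx+Mp(0)$ and $c_1(p)=\int_0^\infty p(x)e^{-x}dx$. The parameter $M$ is unrelated to the constants $M_n$. *)

(* Defs.v *)
From HB Require Import structures.
From mathcomp Require Import all_boot all_order all_algebra.
From mathcomp Require Import all_classical all_reals all_analysis.
Set Implicit Arguments.
Unset Strict Implicit.
Unset Printing Implicit Defensive.
Import Order.TTheory GRing.Theory Num.Theory.
Import numFieldNormedType.Exports.
Local Open Scope classical_set_scope.
Local Open Scope ring_scope.

Section MarkovBernstein.
Variable R : realType.
Implicit Types (M C : R) (n j : nat) (p : {poly R}).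

Definition c1 p : R :=
  Rintegral lebesgue_measure `[0, +oo[ (fun x : R => p.[x] * expR (- x)).

Definition c0 M p : R := c1 p + M * p.[0].

Definition markov_bernstein_ineq M n C : Prop :=
  forall p, (size p <= n.+1)%N -> c1 (p^`() ^+ 2) <= C ^+ 2 * c0 M (p ^+ 2).

(* The Markov-Bernstein constant is the best, i.e. least, nonnegative one.    *)
Definition is_markov_bernstein_constant M n C : Prop :=
  [/\ 0 <= C, markov_bernstein_ineq M n C &
      forall C', 0 <= C' -> markov_bernstein_ineq M n C' -> C <= C'].

Fixpoint A M n : {poly R} :=
  match n with
  | 0 => 1
  | k.+1 => match k with
            | 0 => 'X - ((1 + 2 * M) / (1 + M))%:P
            | l.+1 => ('X - 2%:P) * A M k - A M l
            end
  end.

Definition is_smallest_zero p (x : R) : Prop :=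
  root p x /\ forall y : R, root p y -> x <= y.

Definition p1 M j : R :=
  1 + M * (2 + j%:R) + M ^+ 2 / 6 * (2 + j%:R) * (3 + 2 * j%:R).

Definition p2 M j : R :=
  5 + 5 * M * (3 + j%:R) + M ^+ 2 * (3 + j%:R) * (5 + 2 * j%:R)
  + M ^+ 3 / 6 * (2 + j%:R) * (3 + j%:R) * (5 + 2 * j%:R).

(* Used for n >= 1 only, where n.-1 is the true predecessor.                  *)
Definition q2 M n : R :=
  30 * (1 + (n%:R + 1) * M) / ((n%:R + 1) * (2 * n%:R + 1))
  * (p1 M n.-1 / p2 M n.-1).

End MarkovBernstein.

(* Main.v *)
Require Import Defs.
From HB Require Import structures.
From mathcomp Require Import all_boot all_order all_algebra.
From mathcomp Require Import all_classical all_reals all_analysis.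
From mathcomp Require Import measurable_realfun.
From mathcomp Require Import ring lra.
Import Order.TTheory GRing.Theory Num.Theory.
Import numFieldNormedType.Exports.
Local Open Scope ring_scope.

(* In the orthonormal basis of Laguerre polynomials, write p' = sum_(j < n) d_j
   L_j. As L_(j+1)' = L_j' - L_j and L_j(0) = 1, p is p(0) plus the sum of the
   d_j (L_j - L_(j+1)), so c1(p'^2) = |d|^2, and minimizing c0(p^2) over p(0)
   leaves the quadratic form of a Jacobi matrix K whose characteristic
   polynomial is A_n. Hence M_n^-2 is the least eigenvalue mu of K, with
   positive eigenvector e_j = (-1)^j A_j(mu).
   For the bounds take v_k = 1 + (k+1) M and w = K^-1 v, both explicit. Pairing
   with e gives mu <w, e> = <v, e>, and w <= alpha v then yields
   mu >= 1 / alpha, where 6 alpha is the square of the upper bound on M_n. The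
   lower bound on M_n is mu <= |v|^2 / <v, w> = q_n^(2), which follows from
   mu |w|^2 <= <w, K w> = <v, w> and 0 <= |v - mu w|^2. *)

(** * Moments of the weight [expR (- x)] on the half-line *)

Section Moments.
Local Set Implicit Arguments.
Local Unset Strict Implicit.
Local Open Scope classical_set_scope.
Local Open Scope ring_scope.
Variable R : realType.
Implicit Types (p q : {poly R}) (x : R) (k n : nat).
Local Notation mu := (@lebesgue_measure R).

(** Squeezed below (n+1)! / x, because x^(n+1) / (n+1)! is at most [expR x]. *)
Lemma cvg_exprn_expRN n : x ^+ n * expR (- x) @[x --> +oo] --> (0 : R).
Proof.
have inv_cvg : (n.+1)`!%:R * x^-1 @[x --> +oo] --> (0 : R).
  rewrite -(mulr0 (n.+1)`!%:R); apply: cvgMr.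
  by apply/gtr0_cvgV0; [exact: nbhs_pinfty_gt | exact: cvg_id].
apply: (squeeze_cvgr _ (cvg_cst 0) inv_cvg).
near=> x.
have x0 : 0 < x by near: x; exact: nbhs_pinfty_gt.
rewrite mulr_ge0 ?exprn_ge0 ?expR_ge0 ?(ltW x0)//=.
rewrite expRN ler_pdivrMr ?expR_gt0// mulrAC ler_pdivlMr// -exprSr.
rewrite mulrC -ler_pdivrMr ?ltr0n ?fact_gt0//.
by apply: le_trans (expR_ge1Dxn n (ltW x0)); rewrite lerDr.
Unshelve. all: by end_near. Qed.

Lemma cvg_horner_expRN p : p.[x] * expR (- x) @[x --> +oo] --> (0 : R).
Proof.
rewrite (_ : (fun x => _) =
   (fun x => \sum_(i < size p) p`_i * (x ^+ i * expR (- x)))); last first.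
  apply/funext => x; rewrite horner_coef mulr_suml.
  by apply: eq_bigr => i _; rewrite mulrA.
rewrite -[X in _ --> X](_ : \sum_(i < size p) p`_i * 0 = 0); last first.
  by rewrite big1// => i _; rewrite mulr0.
apply: cvg_big => [|i _]; first exact: add_continuous.
apply: cvgMr; exact: cvg_exprn_expRN.
Qed.

Lemma continuous_horner_expRN p : continuous (fun x : R => p.[x] * expR (- x)).
Proof.
move=> x; apply: cvgM; first exact: continuous_horner.
by apply: continuous_comp; [exact: opp_continuous | exact: continuous_expR].
Qed.

Lemma is_derive_horner_expRN p x :
  is_derive x 1 (fun x => p.[x] * expR (- x)) ((p^`() - p).[x] * expR (- x)).
Proof.
by apply: trigger_derive; rewrite /GRing.scale/= hornerD hornerN; ring.
Qed.

(** This is k! times the Taylor polynomial of degree k of exp; its negative times [expR (- x)] is a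
    primitive of [x ^+ k * expR (- x)]. *)
Fixpoint exp_primitive k : {poly R} :=
  if k is l.+1 then 'X^k + (exp_primitive l) *+ k else 1.

Lemma exp_primitiveE k : exp_primitive k - (exp_primitive k)^`() = 'X^k.
Proof.
elim: k => [|k IH]; first by rewrite derivC subr0.
by rewrite /= derivD derivMn derivXn -IH -mulrnDl subrK addrK.
Qed.

Lemma exp_primitive0 k : (exp_primitive k).[0] = k`!%:R.
Proof.
elim: k => [|k IH]; first by rewrite hornerE.
rewrite /= hornerD hornerMn IH hornerXn expr0n/= add0r factS mulnC natrM.
by rewrite mulr_natr.
Qed.

Lemma integral_exprn_expRN k :
  (\int[mu]_(x in `[0%R, +oo[) (x ^+ k * expR (- x))%:E = k`!%:R%:E)%E.
Proof.
pose F x : R := (- exp_primitive k).[x] * expR (- x).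
have dF x : is_derive x 1 F (x ^+ k * expR (- x)).
  rewrite -hornerXn -exp_primitiveE addrC -derivN -[X in _ + X]opprK.
  exact: is_derive_horner_expRN.
rewrite (@ge0_continuous_FTC2y _ _ F 0 0).
- by rewrite /F oppr0 expR0 mulr1 hornerN exp_primitive0 -EFinB sub0r opprK.
- by move=> x x0; rewrite mulr_ge0 ?exprn_ge0 ?expR_ge0.
- apply: continuous_subspaceT => x.
  by under eq_fun do rewrite -hornerXn; exact: continuous_horner_expRN.
- exact: cvg_horner_expRN.
- by move=> x _; exact: ex_derive.
- by apply: cvg_at_right_filter; exact: continuous_horner_expRN.
- by move=> x _; rewrite derive1E derive_val.
Qed.

Lemma integrable_horner_expRN p :
  mu.-integrable `[0%R, +oo[ (EFin \o (fun x => p.[x] * expR (- x))).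
Proof.
rewrite (_ : (EFin \o _) = (fun x =>
  \sum_(i < size p) (p`_i)%:E * (x ^+ i * expR (- x))%:E))%E; last first.
  apply/funext => x /=; rewrite horner_coef mulr_suml -sumEFin.
  by apply: eq_bigr => i _; rewrite -EFinM mulrA.
apply: integrable_sum => // i _; apply: integrableZl => //.
apply/integrableP; split.
  apply/measurable_EFinP; apply: measurable_funTS.
  apply: continuous_measurable_fun => x.
  by under eq_fun do rewrite -hornerXn; exact: continuous_horner_expRN.
under eq_integral.
  move=> x; rewrite inE/= in_itv/= andbT => x0.
  rewrite ger0_norm ?mulr_ge0 ?exprn_ge0 ?expR_ge0//.
  over.
by rewrite integral_exprn_expRN ltry.
Qed.

Lemma c1D p q : c1 (p + q) = c1 p + c1 q.
Proof.
rewrite /c1 -RintegralD//; try exact: integrable_horner_expRN.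
by apply: eq_Rintegral => x _; rewrite hornerD mulrDl.
Qed.

Lemma c1Z (a : R) p : c1 (a *: p) = a * c1 p.
Proof.
rewrite /c1 -RintegralZl//; try exact: integrable_horner_expRN.
by apply: eq_Rintegral => x _; rewrite hornerZ mulrA.
Qed.

Lemma c1_zmod_morphism : zmod_morphism (@c1 R).
Proof. by move=> p q; rewrite c1D -scaleN1r c1Z mulN1r. Qed.

HB.instance Definition _ :=
  GRing.isZmodMorphism.Build {poly R} R (@c1 R) c1_zmod_morphism.

Lemma c1Xn k : c1 'X^k = k`!%:R :> R.
Proof.
rewrite /c1 /Rintegral; under eq_integral do rewrite hornerXn.
by rewrite integral_exprn_expRN.
Qed.

(* Integration by parts, read off the moments [c1 'X^k = k!]. *)
Lemma c1_deriv p : c1 p^`() = c1 p - p.[0].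
Proof.
rewrite -(coefK p) poly_def horner_sum raddf_sum/= !(raddf_sum (@c1 R)) -sumrB.
apply: eq_bigr => i _; rewrite /= derivZ !c1Z hornerZ -mulrBr; congr (_ * _).
rewrite derivXn raddfMn /= !c1Xn hornerXn; case: (nat_of_ord i) => [|k].
  by rewrite mulr0n expr0 fact0 subrr.
by rewrite expr0n/= subr0 factS mulnC natrM mulr_natr.
Qed.

End Moments.

(** * Laguerre coordinates for [c0] and [c1] *)

Section Laguerre.
Local Set Implicit Arguments.
Local Unset Strict Implicit.
Variable R : realType.
Implicit Types (p q : {poly R}) (d : nat -> R) (i j k n : nat).

Definition laguerre k : {poly R} :=
  \poly_(j < k.+1) ((-1) ^+ j * 'C(k, j)%:R / j`!%:R).

Lemma coef_laguerre k j : (laguerre k)`_j = (-1) ^+ j * 'C(k, j)%:R / j`!%:R.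
Proof.
rewrite coef_poly; case: ltnP => // kj.
by rewrite bin_small// mulr0 mul0r.
Qed.

Lemma size_laguerre k : (size (laguerre k) <= k.+1)%N.
Proof. exact: size_poly. Qed.

Lemma laguerre0 k : (laguerre k).[0] = 1.
Proof. by rewrite horner_coef0 coef_laguerre expr0 bin0 fact0 mulr1 divr1. Qed.

Lemma deriv_laguerre0 : (laguerre 0)^`() = 0.
Proof.
apply/polyP => j.
by rewrite coef_deriv coef0 coef_laguerre bin0n mulr0 mul0r mul0rn.
Qed.

(** Coefficientwise this is Pascal's rule. *)
Lemma deriv_laguerreS k :
  (laguerre k.+1)^`() = (laguerre k)^`() - laguerre k.
Proof.
apply/polyP => j; rewrite coefB !coef_deriv !coef_laguerre binS natrD.
rewrite factS natrM -[LHS]mulr_natr -[X in X - _]mulr_natr exprS.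
have : j`!%:R != 0 :> R by rewrite pnatr_eq0 -lt0n fact_gt0.
have : j.+1%:R != 0 :> R by rewrite pnatr_eq0.
move: (_ ^+ j) 'C(k, j)%:R 'C(k, j.+1)%:R j.+1%:R j`!%:R => x b c m f m0 f0.
by field; rewrite f0.
Qed.

Lemma sum_delta i j : \sum_(k < i) ((k : nat) == j)%:R = (j < i)%:R :> R.
Proof.
elim: i => [|i IH]; first by rewrite big_ord0.
rewrite big_ord_recr /= IH ltnS (leq_eqVlt j i) (eq_sym j).
by case: eqP => [->|_]; rewrite ?ltnn ?add0r ?addr0.
Qed.

(** Iterating the derivative rule gives L_i' = - (L_0 + ... + L_(i-1)). *)
Lemma c1_deriv_laguerreM i q :
  c1 ((laguerre i)^`() * q) = - \sum_(k < i) c1 (laguerre k * q).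
Proof.
elim: i => [|i IH].
  by rewrite big_ord0 deriv_laguerre0 mul0r raddf0 oppr0.
by rewrite big_ord_recr /= deriv_laguerreS mulrBl raddfB /= IH opprD.
Qed.

(* Applying [c1_deriv] to [laguerre i * laguerre j] expresses this entry of the
   Gram matrix through entries of smaller total index. *)
Lemma laguerre_orthonormal i j : c1 (laguerre i * laguerre j) = (i == j)%:R.
Proof.
have [N] := ubnP (i + j); elim: N i j => // N IH i j ijN.
have := c1_deriv (laguerre i * laguerre j).
rewrite derivM c1D hornerM !laguerre0 mulr1 (mulrC (laguerre i) _^`()).
rewrite !c1_deriv_laguerreM.
rewrite (eq_bigr (fun k : 'I_i => ((k : nat) == j)%:R)); last first.
  move=> k _; apply/IH/(leq_trans _ (_ : (i + j <= N)%N)) => //.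
  by rewrite ltn_add2r.
rewrite (eq_bigr (fun k : 'I_j => ((k : nat) == i)%:R)); last first.
  move=> k _; apply/IH/(leq_trans _ (_ : (i + j <= N)%N)) => //.
  by rewrite addnC ltn_add2l.
rewrite !sum_delta => /(congr1 (+%R^~ 1)); rewrite subrK => <-.
by case: ltngtP => _; rewrite ?oppr0 ?addr0 ?add0r ?addNr.
Qed.

Lemma c1_laguerreM n d i : (i < n)%N ->
  c1 (laguerre i * (\sum_(j < n) d j *: laguerre j)) = d i.
Proof.
move=> ltin; rewrite mulr_sumr raddf_sum /= (bigD1 (Ordinal ltin))//=.
rewrite -scalerAr c1Z laguerre_orthonormal eqxx mulr1 big1 ?addr0// => j ji.
rewrite -scalerAr c1Z laguerre_orthonormal (_ : (i == j) = false) ?mulr0//.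
by apply/eqP => eij; case/eqP: ji; apply: val_inj.
Qed.

Lemma parseval n d :
  c1 ((\sum_(j < n) d j *: laguerre j) ^+ 2) = \sum_(j < n) d j ^+ 2.
Proof.
rewrite expr2 {1}mulr_suml raddf_sum; apply: eq_bigr => i _ /=.
by rewrite -scalerAl c1Z c1_laguerreM.
Qed.

Lemma laguerre_expansion n p : (size p <= n)%N ->
  exists d, p = \sum_(j < n) d j *: laguerre j.
Proof.
elim: n p => [|n IH] p.
  by rewrite leqn0 size_poly_eq0 => /eqP ->; exists (fun=> 0); rewrite big_ord0.
(* Subtracting [c *: laguerre n] kills the coefficient of degree n, since that of [laguerre n] is
   (-1)^n / n!, hence nonzero. *)
move=> sp; set c := p`_n / (laguerre n)`_n.
have [|d pd] := IH (p - c *: laguerre n).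
  apply/leq_sizeP => j; rewrite leq_eqVlt => /predU1P[<-|nj].
    rewrite coefB coefZ divfK ?subrr// coef_laguerre binn mulr1.
    by rewrite mulf_neq0 ?signr_eq0// invr_eq0 pnatr_eq0 -lt0n fact_gt0.
  by rewrite coefB coefZ coef_laguerre bin_small// mulr0 mul0r mulr0 subr0
    nth_default// (leq_trans sp).
exists (fun j => if j == n then c else d j).
rewrite big_ord_recr /= eqxx -[LHS](subrK (c *: laguerre n)) pd; congr (_ + _).
by apply: eq_bigr => j _; rewrite ltn_eqF.
Qed.

Lemma deriv0_const p : p^`() = 0 -> p = (p.[0])%:P.
Proof.
move=> dp; apply/polyP => -[|j]; rewrite coefC ?horner_coef0//=.
have /polyP/(_ j)/eqP := dp.
by rewrite coef_deriv coef0 -mulr_natr mulf_eq0 pnatr_eq0 orbF => /eqP.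
Qed.

(* [laguerre j - laguerre j.+1] is the primitive of [laguerre j] vanishing at
   [0]. *)
Definition laguerre_primitive n d (s : R) : {poly R} :=
  s%:P + \sum_(j < n) d j *: (laguerre j - laguerre j.+1).

Lemma deriv_laguerre_primitive n d s :
  (laguerre_primitive n d s)^`() = \sum_(j < n) d j *: laguerre j.
Proof.
rewrite derivD derivC add0r raddf_sum; apply: eq_bigr => j _ /=.
by rewrite derivZ derivB deriv_laguerreS opprB addrCA subrr addr0.
Qed.

Lemma laguerre_primitive0 n d s : (laguerre_primitive n d s).[0] = s.
Proof.
rewrite hornerD hornerC horner_sum big1 ?addr0// => j _.
by rewrite hornerZ hornerD hornerN !laguerre0 subrr mulr0.
Qed.

Lemma size_laguerre_primitive n d s :
  (size (laguerre_primitive n d s) <= n.+1)%N.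
Proof.
rewrite (leq_trans (size_polyD _ _))// geq_max.
rewrite (leq_trans (size_polyC_leq1 _))//=.
apply: (leq_trans (size_sum _ _ _)); apply/bigmax_leqP => j _.
apply: (leq_trans (size_scale_leq _ _)); apply: (leq_trans (size_polyD _ _)).
rewrite size_polyN geq_max !(leq_trans (size_laguerre _))//.
  exact: ltn_ord.
exact: ltnW (ltn_ord j).
Qed.

(** The [d j] with j < n are the coordinates of p'. The value [d n] does not enter the sum; choosing
    0 supplies the boundary condition for summation by parts. *)
Lemma laguerre_primitive_expansion n p : (size p <= n.+1)%N ->
  exists2 d, d n = 0 & p = laguerre_primitive n d p.[0].
Proof.
move=> sp; have sp' : (size p^`() <= n)%N.
  have [->|p0] := eqVneq p 0; first by rewrite deriv0 size_poly0.
  by rewrite -ltnS; apply: leq_trans sp; exact: lt_size_deriv.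
have [d dp] := laguerre_expansion sp'.
exists (fun j => if j == n then 0 else d j); first by rewrite eqxx.
set q := laguerre_primitive _ _ _.
apply/eqP; rewrite -subr_eq0; apply/eqP; rewrite [LHS]deriv0_const.
  by rewrite hornerD hornerN laguerre_primitive0 subrr.
rewrite derivB deriv_laguerre_primitive dp -sumrB big1// => j _.
by rewrite ltn_eqF// subrr.
Qed.

Lemma laguerre_primitiveE n d s : d n = 0 ->
  laguerre_primitive n d s =
  \sum_(k < n.+1) (if (k : nat) is j.+1 then d j.+1 - d j else s + d 0)
    *: laguerre k.
Proof.
(* Adding the vanishing term [d n *: laguerre n] gives an identity valid for every [d], which allows
   induction on n. *)
move=> dn0; rewrite -[LHS]addr0 -[X in _ + X](scale0r (laguerre n)).
rewrite -[X in _ + X *: _]dn0 {dn0}.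
elim: n => [|n IH].
  rewrite /laguerre_primitive big_ord0 addr0 big_ord1 /= scalerDl.
  congr (_ + _); apply/polyP => j; rewrite coefZ coef_laguerre coefC.
  by case: j => [|j]; rewrite ?bin0 ?bin0n ?mulr0 ?mul0r ?mulr0// divr1 !mulr1.
rewrite big_ord_recr /= -IH /laguerre_primitive big_ord_recr /=.
by rewrite scalerBl scalerBr; ring.
Qed.

Lemma c1_deriv_laguerre_primitive n d s :
  c1 ((laguerre_primitive n d s)^`() ^+ 2) = \sum_(j < n) d j ^+ 2.
Proof. by rewrite deriv_laguerre_primitive parseval. Qed.

Lemma c0_laguerre_primitive (M : R) n d s : d n = 0 ->
  c0 M (laguerre_primitive n d s ^+ 2) =
  (s + d 0%N) ^+ 2 + M * s ^+ 2 + \sum_(k < n) (d k.+1 - d k) ^+ 2.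
Proof.
move=> dn0; rewrite /c0 horner_exp laguerre_primitive0 laguerre_primitiveE//.
rewrite (parseval _ (fun k => if k is j.+1 then d j.+1 - d j else s + d 0)).
by rewrite big_ord_recl /= addrAC.
Qed.

End Laguerre.

(** Induction on the degree: divide out the known root and compare it with the smallest root of the
    quotient, if there is one. *)
Lemma exists_smallest_zero (R : realType) (p : {poly R}) (x : R) :
  p != 0 -> root p x -> exists y, is_smallest_zero p y.
Proof.
have [N] := ubnP (size p); elim: N p x => // N IH p x pN p0 px.
have [q pq] := factor_theorem _ _ px.
have q0 : q != 0 by apply: contraNneq p0 => q0; rewrite pq q0 mul0r.
have [[z qz]|noroot] := pselect (exists z, root q z); last first.
  exists x; split => // y; rewrite pq rootM root_XsubC => /orP[qy|/eqP->//].
  by exfalso; apply: noroot; exists y.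
have [|y [qy ymin]] := IH q z _ q0 qz.
  by move: pN; rewrite pq size_Mmonic ?monicXsubC// size_XsubC addn2.
exists (Num.min x y); split.
  by case: leP => _ //; rewrite pq rootM qy.
move=> u; rewrite pq rootM root_XsubC ge_min => /orP[/ymin ->|/eqP ->].
  by rewrite orbT.
by rewrite lexx.
Qed.

(** * The Jacobi matrix, its quadratic form and its least eigenvalue *)

Section Jacobi.
Local Set Implicit Arguments.
Local Unset Strict Implicit.
Variables (R : realType) (M : R).
Hypothesis M_ge0 : 0 <= M.
Implicit Types (d f g : nat -> R) (x : R) (j k m n : nat).

Let M1_gt0 : 0 < 1 + M. Proof. by rewrite ltr_wpDr. Qed.
Let M1_neq0 : 1 + M != 0. Proof. by rewrite gt_eqF. Qed.

(** The matrix acts on infinite sequences; its truncation to size n is encoded by the condition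
    [g n = 0]. *)
Definition jacobi g k : R :=
  if k is j.+1 then 2 * g j.+1 - g j - g j.+2
  else (1 + 2 * M) / (1 + M) * g 0 - g 1.

(** Polar form of what [c0_laguerre_primitive] leaves after minimizing over s: the minimum of (s +
    d_0)^2 + M s^2 is M / (1 + M) d_0^2. *)
Definition energy n f g : R :=
  M / (1 + M) * f 0 * g 0 + \sum_(k < n) (f k.+1 - f k) * (g k.+1 - g k).

Lemma energyC n f g : energy n f g = energy n g f.
Proof.
rewrite /energy -!mulrA (mulrC (f 0)); congr (_ + _).
by apply: eq_bigr => k _; rewrite mulrC.
Qed.

Lemma energy_jacobi n f g : f n = 0 ->
  energy n f g = \sum_(k < n) f k * jacobi g k.
Proof.
move=> fn0.
(* Summation by parts, with the boundary term at n kept so that the induction needs no condition on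
   [f]. *)
have -> : energy n f g =
    \sum_(k < n) f k * jacobi g k + f n * (jacobi g n + g n.+1 - g n).
  rewrite /energy; elim: n {fn0} => [|n IH].
    by rewrite !big_ord0 /jacobi /=; field.
  by rewrite !big_ord_recr /= addrA IH /=; ring.
by rewrite fn0 mul0r addr0.
Qed.

(** The sign makes these values positive to the left of all zeros and turns the recurrence into the
    eigenvalue equation of [jacobi]. *)
Definition altA n x : R := (-1) ^+ n * (A M n).[x].

Lemma altA0 x : altA 0 x = 1.
Proof. by rewrite /altA expr0 hornerC mulr1. Qed.

Lemma altA1 x : altA 1 x = (1 + 2 * M) / (1 + M) - x.
Proof. by rewrite /altA /= !hornerE; ring. Qed.

Lemma altASS n x : altA n.+2 x = (2 - x) * altA n.+1 x - altA n x.
Proof.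
rewrite /altA -[A M n.+2]/(('X - 2%:P) * A M n.+1 - A M n).
by rewrite hornerD hornerN hornerM hornerXsubC !exprS; ring.
Qed.

Lemma jacobi_altA x k : jacobi (altA^~ x) k = x * altA k x.
Proof.
case: k => [|k]; first by rewrite /jacobi altA0 altA1; ring.
by rewrite /jacobi altASS; ring.
Qed.

Lemma altA_eq0 n x : (altA n x == 0) = root (A M n) x.
Proof. by rewrite mulf_eq0 signr_eq0. Qed.

(** For x <= 0 the sequence starts at 1 and never decreases, as a_(n+2) - a_(n+1) = (a_(n+1) - a_n)
    - x a_(n+1). *)
Lemma altA_ge1 n x : x <= 0 -> 1 <= altA n x.
Proof.
move=> x0; suff: 1 <= altA n x /\ altA n x <= altA n.+1 x by case.
elim: n => [|n [IH1 IH2]].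
  rewrite altA0 altA1; split => //.
  have : 0 <= M / (1 + M) by rewrite divr_ge0// ltW.
  have -> : (1 + 2 * M) / (1 + M) = 1 + M / (1 + M) by field.
  lra.
split; first exact: le_trans IH2.
have : 0 <= - x * altA n.+1 x.
  by rewrite mulr_ge0 ?oppr_ge0// (le_trans _ IH2)// (le_trans _ IH1).
rewrite altASS; lra.
Qed.

Lemma A_neq0 n : A M n != 0.
Proof.
apply/eqP => A0; have := altA_ge1 n (lexx 0).
by rewrite /altA A0 horner0 mulr0 ler10.
Qed.

Lemma altA_ivt n x : altA n x <= 0 ->
  exists2 y, 0 < y <= x & root (A M n) y.
Proof.
move=> Ax.
have x0 : 0 <= x.
  by rewrite leNgt; apply/negP => /ltW/(altA_ge1 n); lra.
have [|y /andP[y0 yx] yroot] :=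
    @poly_ivt R (- ((-1) ^+ n *: A M n)) 0 x x0.
  rewrite !hornerN !hornerZ -!/(altA _ _) oppr_le0 oppr_ge0 Ax andbT.
  by rewrite (le_trans ler01)// altA_ge1.
have Ay : root (A M n) y.
  by move: yroot; rewrite /root hornerN hornerZ oppr_eq0 mulf_eq0 signr_eq0.
exists y => //; rewrite yx andbT lt_neqAle y0 andbT.
apply/eqP => y0'; move: Ay; rewrite -altA_eq0 -y0' gt_eqF//.
by rewrite (lt_le_trans ltr01)// altA_ge1.
Qed.

Lemma smallest_zero_gt0 n x : is_smallest_zero (A M n) x -> 0 < x.
Proof.
move=> [xroot xmin]; rewrite ltNge; apply/negP => /(altA_ge1 n).
by move: xroot; rewrite -altA_eq0 => /eqP ->; rewrite ler10.
Qed.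

(* The smallest zeros decrease strictly with [n]: at that of [A M n.+1] the
   recurrence gives [altA n.+2] the sign opposite to [altA n]. *)
Lemma exists_ground_state n : exists2 x, is_smallest_zero (A M n.+1) x &
  forall y j, y <= x -> (j <= n)%N -> 0 < altA j y.
Proof.
elim: n => [|n [x xmin IH]].
  exists ((1 + 2 * M) / (1 + M)).
    split; first by rewrite -altA_eq0 altA1 subrr.
    by move=> y; rewrite -altA_eq0 altA1 subr_eq0 => /eqP ->.
  by move=> y j _; rewrite leqn0 => /eqP ->; rewrite altA0.
have [|y /andP[y0 yx] yroot] := @altA_ivt n.+2 x.
  have /eqP : altA n.+1 x == 0 by rewrite altA_eq0; case: xmin.
  by rewrite altASS => ->; rewrite mulr0 sub0r oppr_le0 ltW ?IH.
have [z [zroot zmin]] := exists_smallest_zero _ _ _ (A_neq0 n.+2) yroot.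
have ltzx : z < x.
  rewrite lt_neqAle (le_trans (zmin _ yroot) yx) andbT.
  apply/eqP => zx; move: zroot; rewrite zx -altA_eq0 altASS.
  have /eqP : altA n.+1 x == 0 by rewrite altA_eq0; case: xmin.
  by move=> ->; rewrite mulr0 sub0r oppr_eq0 gt_eqF// IH.
exists z => // u j uz; rewrite leq_eqVlt => /predU1P[->|]; last first.
  by rewrite ltnS; apply: IH; exact: ltW (le_lt_trans uz ltzx).
rewrite ltNge; apply/negP => /altA_ivt[v /andP[_ vu] vroot].
case: xmin => _ /(_ _ vroot); lra.
Qed.

Lemma ground_state_gt0 n x j : is_smallest_zero (A M n) x -> (j < n)%N ->
  0 < altA j x.
Proof.
case: n => // n [xroot xmin] jn.
have [y [yroot ymin] pos] := exists_ground_state n.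
by apply: pos => //; exact: xmin.
Qed.

(* Picone's inequality: each squared increment is bounded below using the ratio
   of consecutive entries of the positive ground state, and the sum telescopes. *)
Lemma ground_state_rayleigh n x d : (0 < n)%N -> is_smallest_zero (A M n) x ->
  d n = 0 -> x * \sum_(k < n) d k ^+ 2 <= energy n d d.
Proof.
case: n => // n _ xmin dn0.
(* The [d m ^+ 2] term is the telescoping remainder. For m = 0 its coefficient is M / (1 + M), which
   gives equality. *)
have step m : (m <= n)%N ->
    x * (\sum_(k < m) d k ^+ 2)
      + (x - 1 + altA m.+1 x / altA m x) * d m ^+ 2 <= energy m d d.
  elim: m => [_|m IH mn].
    rewrite /energy !big_ord0 altA0 altA1 addr0 mulr0 add0r divr1.
    rewrite le_eqVlt; apply/orP; left; apply/eqP; field.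
    exact: M1_neq0.
  have {}IH := IH (ltnW mn).
  have Am : 0 < altA m x by apply: (ground_state_gt0 xmin); rewrite ltnS ltnW.
  have Am1 : 0 < altA m.+1 x by apply: (ground_state_gt0 xmin).
  rewrite /energy !big_ord_recr /= addrA -/(energy m d d) altASS.
  set r := altA m.+1 x / altA m x in IH.
  have r0 : 0 < r by rewrite divr_gt0.
  have -> : ((2 - x) * altA m.+1 x - altA m x) / altA m.+1 x = 2 - x - r^-1.
    by rewrite /r; field; rewrite !gt_eqF.
  have : 0 <= r^-1 * (r * d m - d m.+1) ^+ 2.
    by rewrite mulr_ge0 ?sqr_ge0// invr_ge0 ltW.
  have -> : r^-1 * (r * d m - d m.+1) ^+ 2 =
     r * d m ^+ 2 - 2 * d m * d m.+1 + r^-1 * d m.+1 ^+ 2.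
    by field; rewrite gt_eqF.
  nra.
have := step n (leqnn n).
(* The ratio vanishes at the zero, and [d n.+1 = 0] makes the last increment contribute [d n ^+ 2],
   which absorbs the -1. *)
have /eqP -> : altA n.+1 x == 0 by rewrite altA_eq0; case: xmin.
rewrite mul0r addr0 big_ord_recr /= /energy big_ord_recr /= dn0.
nra.
Qed.

End Jacobi.

(** * The Markov-Bernstein constant and explicit bounds on the smallest zero *)

Section Bounds.
Local Set Implicit Arguments.
Local Unset Strict Implicit.
Variables (R : realType) (M : R) (n : nat) (mu : R).
Hypotheses (M_ge0 : 0 <= M) (n_gt0 : (0 < n)%N).
Hypothesis mu_min : is_smallest_zero (A M n) mu.
Implicit Types (k : nat).

Let mu_gt0 : 0 < mu. Proof. exact: smallest_zero_gt0 mu_min. Qed.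
Let M1_neq0 : 1 + M != 0. Proof. by rewrite gt_eqF// ltr_wpDr. Qed.
Let nM_gt0 : 0 < 1 + (n%:R + 1) * M.
Proof. by rewrite ltr_wpDr// mulr_ge0// addr_ge0. Qed.

Let e := (altA M)^~ mu.

Let e_n : e n = 0.
Proof. by apply/eqP; rewrite altA_eq0; case: mu_min. Qed.

Let e_gt0 k : (k < n)%N -> 0 < e k.
Proof. exact: ground_state_gt0 mu_min. Qed.

Lemma c1_deriv_le_c0 (p : {poly R}) : (size p <= n.+1)%N ->
  mu * c1 (p^`() ^+ 2) <= c0 M (p ^+ 2).
Proof.
move=> /laguerre_primitive_expansion[d dn0 ->]; set s := p.[0].
rewrite c1_deriv_laguerre_primitive c0_laguerre_primitive//.
apply: le_trans (ground_state_rayleigh M_ge0 n_gt0 mu_min dn0) _.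
rewrite /energy (eq_bigr (fun k : 'I_n => (d k.+1 - d k) ^+ 2)) => [|k _];
  last by rewrite expr2.
rewrite lerD2r -subr_ge0.
(* Completing the square in s; the minimizer is s = - d_0 / (1 + M). *)
have -> : (s + d 0) ^+ 2 + M * s ^+ 2 - M / (1 + M) * d 0 * d 0 =
    (1 + M) * (s + d 0 / (1 + M)) ^+ 2 by field.
by rewrite mulr_ge0 ?sqr_ge0// addr_ge0.
Qed.

Lemma c1_deriv_eq_c0 : exists2 p : {poly R}, (size p <= n.+1)%N &
  0 < c1 (p^`() ^+ 2) /\ c0 M (p ^+ 2) = mu * c1 (p^`() ^+ 2).
Proof.
(* The eigenvector [e] as coordinates of p', with the minimizing value at 0, gives equality. *)
exists (laguerre_primitive n e (- e 0 / (1 + M))).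
  exact: size_laguerre_primitive.
rewrite c1_deriv_laguerre_primitive c0_laguerre_primitive//; split.
  case: n n_gt0 e_gt0 => // m _ e_gt0'.
  rewrite big_ord_recl ltr_wpDr ?exprn_gt0 ?e_gt0'//.
  by apply: sumr_ge0 => k _; exact: sqr_ge0.
transitivity (energy M n e e).
  rewrite /energy; congr (_ + _); by field.
rewrite energy_jacobi// mulr_sumr; apply: eq_bigr => k _.
by rewrite jacobi_altA mulrCA expr2.
Qed.

Lemma markov_bernstein_constant :
  is_markov_bernstein_constant M n (1 / Num.sqrt mu).
Proof.
have smu : 0 < Num.sqrt mu by rewrite sqrtr_gt0.
split; first by rewrite divr_ge0// sqrtr_ge0.
  move=> p sp; rewrite expr_div_n expr1n sqr_sqrtr ?(ltW mu_gt0)// mul1r.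
  by rewrite mulrC ler_pdivlMr// mulrC c1_deriv_le_c0.
move=> C C0 /(_ _ _)MB; have [p sp [c1p c0p]] := c1_deriv_eq_c0.
have := MB p sp; rewrite c0p mulrA ler_pMl// => Cmu.
rewrite ler_pdivrMr// -[leLHS]ger0_norm// -[leRHS]ger0_norm; last first.
  by rewrite mulr_ge0// sqrtr_ge0.
rewrite -[_ <= _]ler_sqr ?nnegrE ?normr_ge0// !real_normK ?num_real//.
by rewrite expr1n exprMn sqr_sqrtr// ltW.
Qed.

(* [v] is proportional to [altA^~ 0], so that [jacobi v = 0], and [w] solves
   [jacobi w = v]; the condition [w n = 0] determines [alpha]. *)
Let v k : R := 1 + (k%:R + 1) * M.

Let alpha : R := n%:R * (n%:R + 1) * (3 + (n%:R + 2) * M)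
  / (1 + (n%:R + 1) * M) / 6.

Let w k : R := alpha * v k
  - (k%:R + 1) * k%:R / 2 - M * (k%:R + 1) * k%:R * (k%:R + 2) / 6.

Let v_gt0 k : 0 < v k.
Proof. by rewrite ltr_wpDr// mulr_ge0// addr_ge0. Qed.

Let w_n : w n = 0.
Proof. by rewrite /w /alpha /v; field; rewrite gt_eqF. Qed.

Let jacobi_w k : jacobi M w k = v k.
Proof.
rewrite /jacobi /w /v; case: k => [|k]; first by field.
by rewrite -[k.+2%:R]natr1 -[k.+1%:R]natr1; field.
Qed.

Let w_le k : w k <= alpha * v k.
Proof.
rewrite /w -addrA gerDl -opprD oppr_le0.
by rewrite addr_ge0// divr_ge0// !mulr_ge0// addr_ge0.
Qed.

Lemma smallest_zero_lower_bound :
  1 <= mu * (n%:R * (n%:R + 1) * (3 + (n%:R + 2) * M)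
    / (1 + (n%:R + 1) * M) / 6).
Proof.
rewrite -/alpha.
have ev : \sum_(k < n) e k * v k = mu * \sum_(k < n) e k * w k.
  rewrite (eq_bigr (fun k : 'I_n => e k * jacobi M w k)) => [|k _].
    (* The symmetry of [energy] moves [jacobi] from [w] to [e], by means of both [e n = 0] and
       [w n = 0]. *)
    rewrite -energy_jacobi// energyC energy_jacobi// mulr_sumr.
    by apply: eq_bigr => k _; rewrite jacobi_altA /e; ring.
  by rewrite jacobi_w.
have ew : \sum_(k < n) e k * w k <= alpha * \sum_(k < n) e k * v k.
  rewrite mulr_sumr; apply: ler_sum => k _.
  by rewrite mulrCA ler_wpM2l// ltW// e_gt0.
have ev0 : 0 < \sum_(k < n) e k * v k.
  case: n n_gt0 e_gt0 => // m _ e_gt0'.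
  rewrite big_ord_recl ltr_wpDr//; last first.
    by apply: mulr_gt0; [exact: e_gt0' | exact: v_gt0].
  by apply: sumr_ge0 => k _; rewrite mulr_ge0// ltW// e_gt0'// ltn_ord.
rewrite -(ler_pM2r ev0) mul1r -mulrA {1}ev ler_wpM2l//.
exact: ltW.
Qed.

Let sum_vv m : \sum_(k < m) v k ^+ 2 =
  m%:R * (1 + M * (m%:R + 1) + M ^+ 2 / 6 * (m%:R + 1) * (2 * m%:R + 1)).
Proof.
elim: m => [|m IH]; first by rewrite big_ord0 mul0r.
by rewrite big_ord_recr /= IH /v -natr1; field.
Qed.

(** The bracket is [alpha * v k - w k], so this sum yields <v, w> from |v|^2. *)
Let sum_v_corr m : \sum_(k < m) v k *
    ((k%:R + 1) * k%:R / 2 + M * (k%:R + 1) * k%:R * (k%:R + 2) / 6) =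
  (m%:R - 1) * m%:R * (m%:R + 1) *
  (1 / 6 + M * (3 * m%:R + 2) / 24 + M * (m%:R + 2) / 24
   + M ^+ 2 * (m%:R + 2) * (2 * m%:R + 1) / 60).
Proof.
elim: m => [|m IH]; first by rewrite big_ord0 mulr0 !mul0r.
by rewrite big_ord_recr /= IH /v -natr1; field.
Qed.

Lemma smallest_zero_upper_bound : mu <= q2 M n.
Proof.
set V := \sum_(k < n) v k ^+ 2; set S := \sum_(k < n) v k * w k.
set W := \sum_(k < n) w k ^+ 2.
have WS : mu * W <= S.
  apply: le_trans (ground_state_rayleigh M_ge0 n_gt0 mu_min w_n) _.
  rewrite energy_jacobi// le_eqVlt; apply/orP; left; apply/eqP.
  by apply: eq_bigr => k _; rewrite jacobi_w mulrC.
have SV : mu * S <= V.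
  have : 0 <= \sum_(k < n) (v k - mu * w k) ^+ 2.
    by apply: sumr_ge0 => k _; exact: sqr_ge0.
  have -> : \sum_(k < n) (v k - mu * w k) ^+ 2 =
      V - 2 * mu * S + mu * (mu * W).
    rewrite /V /S /W !mulr_sumr -sumrB -big_split; apply: eq_bigr => k _ /=.
    ring.
  have := ler_wpM2l (ltW mu_gt0) WS; lra.
have n1 : (n.-1)%:R = n%:R - 1 :> R.
  by rewrite -[in RHS](prednK n_gt0) -natr1 addrK.
have n0 : 0 < n%:R :> R by rewrite ltr0n.
(* Up to explicit factors, [p1] and [p2] at n - 1 are |v|^2 and <v, w>. *)
have VE : V = n%:R * p1 M n.-1.
  by rewrite /V sum_vv /p1 n1; field.
have p2_gt0 : 0 < p2 M n.-1.
  by rewrite /p2 n1 -!addrA ltr_wpDr// !addr_ge0// !mulr_ge0 ?exprn_ge0//;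
    lra.
have SE : S = n%:R * (n%:R + 1) * (2 * n%:R + 1) * p2 M n.-1
              / (30 * (1 + (n%:R + 1) * M)).
  have -> : S = alpha * V - \sum_(k < n) v k *
    ((k%:R + 1) * k%:R / 2 + M * (k%:R + 1) * k%:R * (k%:R + 2) / 6).
    rewrite /S /V mulr_sumr -sumrB; apply: eq_bigr => k _.
    by rewrite /w; ring.
  rewrite sum_v_corr VE /alpha /p1 /p2 n1.
  by field; rewrite gt_eqF.
have S0 : 0 < S.
  by rewrite SE divr_gt0 ?mulr_gt0// ltr_wpDr// ?mulr_ge0//; lra.
have -> : q2 M n = V / S.
  rewrite SE VE /q2; field.
  by rewrite !gt_eqF//; lra.
by rewrite ler_pdivlMr.
Qed.

End Bounds.

Theorem corollary2p13 (R : realType) (M : R) (n : nat) (mu Mn : R)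
    (hM : 0 <= M) (hn : (1 <= n)%N)
    (hmu : is_smallest_zero (A M n) mu) (hMn : Mn = 1 / Num.sqrt mu) :
  [/\ is_markov_bernstein_constant M n Mn,
      1 / Num.sqrt (q2 M n) <= Mn &
      Mn <= Num.sqrt (n%:R * (n%:R + 1) * (3 + (n%:R + 2) * M)
                      / (1 + (n%:R + 1) * M))].
Proof.
have mu_gt0 := smallest_zero_gt0 hM hmu.
rewrite hMn !div1r; split.
- by rewrite -div1r; exact: markov_bernstein_constant.
- have muq := smallest_zero_upper_bound hM hn hmu.
  by rewrite lef_pV2 ?posrE ?sqrtr_gt0 ?(lt_le_trans mu_gt0)// ler_wsqrtr.
- rewrite -sqrtrV ?(ltW mu_gt0)// ler_wsqrtr//.
  have nM_gt0 : 0 < 1 + (n%:R + 1) * M.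
    by rewrite ltr_wpDr// mulr_ge0// addr_ge0.
  set b := (X in _ <= X).
  have b0 : 0 <= b.
    by rewrite divr_ge0 ?(ltW nM_gt0)// !mulr_ge0 ?addr_ge0 ?mulr_ge0 ?addr_ge0.
  (* This gives 6 <= mu b, which is stronger than the required 1 <= mu b. *)
  have := smallest_zero_lower_bound hM hn hmu; rewrite -/b.
  rewrite -[mu^-1]div1r ler_pdivrMr//.
  have : 0 <= mu * b by rewrite mulr_ge0// ltW.
  lra.
Qed.
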